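(* Let $n\ge 1$ and let $X$ be a finite pure $n$-dimensional weighted simplicial complex such that all the links of $X$ of dimension $>0$ (including $X=X_\emptyset$) are connected. If $X$ is $(n+1)$-partite with sides $S_0,\dots,S_n$, then $\frac{n+1}{n} \in \mathrm{Spec} (\Delta_0^+)$ and the space of eigenfunctions of $\Delta_0^+$ with eigenvalue $\frac{n+1}{n}$ is spanned by the functions $\varphi_i$, $0 \leq i \leq n$, defined on vertices by $$\varphi_i (u) = \begin{cases} n & u \in S_i \\ -1 & \text{otherwise.} \end{cases}$$
   Context: $X$ is pure $n$-dimensional if every simplex is a face of an $n$-simplex. $X^{(k)}$ is the set of $k$-simplices and $\Sigma(k)$ the set of ordered $k$-simplices ($(k+1)$-tuples of vertices forming a $k$-simplex), $-1\le k\le n$, with $X^{(-1)}=\Sigma(-1)=\{\emptyset\}$. Weighted means equipped with a balanced weight function: a function $m:\bigcup_{-1\le k\le n}X^{(k)}\to(0,\infty)$ with $\sum_{\sigma\in X^{(k+1)},\tau\subset\sigma}m(\sigma)=m(\tau)$ for all $-1\le k\le n-1$, $\tau\in X^{(k)}$. It is extended to ordered simplices by forgetting the order. $C^k(X,\mathbb R)$ is the space of antisymmetric functions $\Sigma(k)\to\mathbb R$ with inner product $\langle\phi,\psi\rangle=\sum_{\tau\in\Sigma(k)}\frac{m(\tau)}{(k+1)!}\phi(\tau)\psi(\tau)$; in particular $C^0(X,\mathbb R)$ is the space of real functions on vertices. $d_0:C^0\to C^1$ is $(d_0\phi)((v_0,v_1))=\phi(v_1)-\phi(v_0)$, $\delta_0$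 is its adjoint, and $\Delta_0^+=\delta_0d_0$, i.e. $\Delta_0^+\phi(u)=\phi(u)-\sum_{v:(u,v)\in\Sigma(1)}\frac{m((u,v))}{m(u)}\phi(v)$. For a simplex $\tau$ of dimension $j$, the link $X_\tau$ is the complex of simplices $\sigma$ disjoint from $\tau$ with $\tau\cup\sigma$ a simplex of $X$; it is pure of dimension $n-j-1$, and $X_\emptyset=X$. $X$ is $(n+1)$-partite with sides $S_0,\dots,S_n$ if $X^{(0)}=S_0\cup\dots\cup S_n$ is a disjoint partition such that any two vertices joined by an edge lie in different sides. *)

(* Defs.v *)
From HB Require Import structures.
From mathcomp Require Import all_boot all_order all_algebra.
From mathcomp Require Import boolp reals ring.

Set Implicit Arguments.
Unset Strict Implicit.
Unset Printing Implicit Defensive.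

Import Order.TTheory GRing.Theory Num.Theory.
Local Open Scope ring_scope.

(* A k-simplex is a face s with #|s| = k.+1; set0 is the (-1)-simplex.  The
   ground type V may contain points that are not vertices, so that the links
   of a complex on V are again complexes on V. *)
Definition is_complex (V : finType) (X : {set {set V}}) : Prop :=
  set0 \in X /\
  forall s t : {set V}, t \subset s -> s \in X -> t \in X.

Definition pure (V : finType) (n : nat) (X : {set {set V}}) : Prop :=
  forall t : {set V}, t \in X ->
  exists s : {set V}, [/\ s \in X, #|s| = n.+1 & t \subset s].

(* Integer valued: the complex [set set0] has dimension -1. *)
Definition complex_dim (V : finType) (X : {set {set V}}) : int :=
  (\max_(s in X) #|s|)%N%:Z - 1.

Definition link (V : finType) (X : {set {set V}}) (t : {set V}) :
    {set {set V}} :=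
  [set s in X | [disjoint s & t] && (t :|: s \in X)].

Definition adjacent (V : finType) (X : {set {set V}}) : rel V :=
  fun u v => (u != v) && ([set u; v] \in X).

Definition vertices (V : finType) (X : {set {set V}}) : {set V} :=
  [set v | [set v] \in X].

Definition complex_connected (V : finType) (X : {set {set V}}) : Prop :=
  forall u v : V, u \in vertices X -> v \in vertices X ->
  connect (adjacent X) u v.

Definition partite (V : finType) (X : {set {set V}}) (k : nat)
    (S : 'I_k -> {set V}) : Prop :=
  [/\ vertices X = \bigcup_(i < k) S i,
      forall i j : 'I_k, i != j -> [disjoint S i & S j]
    & forall (u v : V) (i j : 'I_k),
        adjacent X u v -> u \in S i -> v \in S j -> i != j].

(* Only the values of weight on simplices matter. *)
Record weighted_complex (R : realType) (n : nat) (V : finType) :=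
  WeightedComplex {
    faces :> {set {set V}};
    weight : {set V} -> R;
    complex_faces : is_complex faces;
    pure_faces : pure n faces;
    weight_gt0 : forall t : {set V}, t \in faces -> 0 < weight t;
    weight_balanced : forall t : {set V}, t \in faces -> (#|t| <= n)%N ->
      \sum_(s in faces | (#|s| == #|t|.+1) && (t \subset s)) weight s
        = weight t
  }.

Section Laplacian.
Context {R : realType} {n : nat} {V : finType} (X : weighted_complex R n V).

Definition vertex : Type := {v : V | v \in vertices X}.
HB.instance Definition _ := SubFinite.on vertex.

(* The ordered 1-simplices, Sigma(1). *)
Definition edge : Type :=
  {e : vertex * vertex | adjacent X (val e.1) (val e.2)}.
HB.instance Definition _ := SubFinite.on edge.

Definition src (e : edge) : vertex := (val e).1.
Definition tgt (e : edge) : vertex := (val e).2.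

Definition vweight (u : vertex) : R := weight X [set val u].
Definition eweight (u v : vertex) : R := weight X [set val u; val v].

Lemma adjacentC (u v : V) : adjacent X u v = adjacent X v u.
Proof. by rewrite /adjacent eq_sym setUC. Qed.

Fact rev_edge_subproof (e : edge) :
  adjacent X (val (tgt e, src e).1) (val (tgt e, src e).2).
Proof. by rewrite /= adjacentC (valP e). Qed.

Definition rev_edge (e : edge) : edge :=
  exist _ (tgt e, src e) (rev_edge_subproof e).

Lemma rev_edgeK : involutive rev_edge.
Proof. by move=> [[u v] uv]; apply: val_inj. Qed.

Definition C0 : vectType R := {ffun vertex -> R^o}.

Definition symmetrize (f : {ffun edge -> R^o}) : {ffun edge -> R^o} :=
  [ffun e => f e + f (rev_edge e)].

Fact symmetrize_linear : linear symmetrize.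
Proof.
move=> a f g; apply/ffunP => e; rewrite !ffunE scalerDr.
by rewrite addrACA.
Qed.
HB.instance Definition _ := GRing.isLinear.Build R {ffun edge -> R^o}
  {ffun edge -> R^o} *:%R symmetrize symmetrize_linear.

Definition antisym : {vspace {ffun edge -> R^o}} := lker (linfun symmetrize).

Lemma antisymP (f : {ffun edge -> R^o}) :
  reflect (forall e, f (rev_edge e) = - f e) (f \in antisym).
Proof.
rewrite memv_ker lfunE /=; apply: (iffP eqP) => [/ffunP h e|h].
  by have := h e; rewrite !ffunE => /eqP; rewrite addrC addr_eq0 => /eqP.
by apply/ffunP => e; rewrite !ffunE h subrr.
Qed.

Definition C1 : vectType R := subvs_of antisym.

Definition inner0 (phi psi : C0) : R :=
  \sum_(u : vertex) vweight u * phi u * psi u.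

(* Each unordered edge is counted twice, whence the factor 1 / 2!. *)
Definition inner1 (phi psi : C1) : R :=
  \sum_(e : edge)
     eweight (src e) (tgt e) / 2%:R * (val phi) e * (val psi) e.

Definition diff0 (phi : C0) : {ffun edge -> R^o} :=
  [ffun e => phi (tgt e) - phi (src e)].

Fact diff0_antisym (phi : C0) : diff0 phi \in antisym.
Proof. by apply/antisymP => e; rewrite !ffunE opprB. Qed.

Definition coboundary0 (phi : C0) : C1 := vsproj antisym (diff0 phi).

Fact coboundary0_linear : linear coboundary0.
Proof.
move=> a f g; apply: val_inj => /=.
rewrite !vsprojK ?diff0_antisym //.
by apply/ffunP => e; rewrite !ffunE scalerBr opprD addrACA.
Qed.
HB.instance Definition _ := GRing.isLinear.Build R C0 C1 *:%R
  coboundary0 coboundary0_linear.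

Definition d0 : 'Hom(C0, C1) := linfun coboundary0.

Lemma d0E (phi : C0) (e : edge) :
  val (d0 phi) e = phi (tgt e) - phi (src e).
Proof. by rewrite lfunE /= vsprojK ?diff0_antisym // ffunE. Qed.

Definition is_adjoint (d : 'Hom(C0, C1)) (delta : 'Hom(C1, C0)) : Prop :=
  forall (phi : C0) (psi : C1), inner1 (d phi) psi = inner0 phi (delta psi).

Definition codiff0 (psi : C1) : C0 :=
  [ffun u => \sum_(e : edge | tgt e == u)
      eweight (src e) (tgt e) / vweight u * (val psi) e].

Fact codiff0_linear : linear codiff0.
Proof.
move=> a f g; apply/ffunP => u; rewrite !ffunE scaler_sumr -big_split /=.
apply: eq_bigr => e _; rewrite !ffunE mulrDr; congr (_ + _).
by rewrite [RHS]mulrCA.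
Qed.
HB.instance Definition _ := GRing.isLinear.Build R C1 C0 *:%R
  codiff0 codiff0_linear.

Lemma vweight_gt0 (u : vertex) : 0 < vweight u.
Proof. by apply: weight_gt0; have := valP u; rewrite inE. Qed.

Lemma eweightC (u v : vertex) : eweight u v = eweight v u.
Proof. by rewrite /eweight setUC. Qed.

Lemma codiff0_adjoint : is_adjoint d0 (linfun codiff0).
Proof.
move=> phi psi; rewrite /inner1 /inner0.
have psiA e : (val psi) (rev_edge e) = - (val psi) e.
  by move: e; apply/antisymP; exact: subvsP.
pose F e := eweight (src e) (tgt e) / 2%:R * phi (tgt e) * (val psi) e.
transitivity (\sum_e F e *+ 2).
  transitivity (\sum_e (F e + F (rev_edge e))).
    apply: eq_bigr => e _; rewrite d0E /F psiA eweightC /src /tgt /=.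
    by rewrite mulrBr mulrBl mulrN.
  rewrite big_split /= [X in _ + X](_ : _ = \sum_e F e).
    by rewrite -mulr2n -sumrMnl.
  by rewrite [RHS](reindex_inj (inv_inj rev_edgeK)).
rewrite (partition_big tgt xpredT) //=; apply: eq_bigr => u _.
rewrite lfunE ffunE mulr_sumr; apply: eq_bigr => e /eqP <-.
have H (a b c w : R) :
  w != 0 -> a / 2%:R * b * c *+ 2 = w * b * (a / w * c).
  by move=> w0; field.
by apply: H; rewrite gt_eqF ?vweight_gt0.
Qed.

Lemma adjoint_exists : exists delta, is_adjoint d0 delta.
Proof. by exists (linfun codiff0); exact: codiff0_adjoint. Qed.

(* The choice made by cid is harmless, by adjoint_unique below. *)
Definition delta0 : 'Hom(C1, C0) := sval (cid adjoint_exists).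

Definition laplacian : 'End(C0) := (delta0 \o d0)%VF.

Lemma delta0_adjoint : is_adjoint d0 delta0.
Proof. exact: (svalP (cid adjoint_exists)). Qed.

Lemma adjoint_unique delta delta' :
  is_adjoint d0 delta -> is_adjoint d0 delta' -> delta = delta'.
Proof.
move=> h h'; apply/lfunP => psi; apply/ffunP => u.
pose phi : C0 := [ffun v => (v == u)%:R].
have E (g : C0) : inner0 phi g = vweight u * g u.
  rewrite /inner0 (bigD1 u) //= big1 ?addr0 => [|v /negPf vu].
    by rewrite ffunE eqxx mulr1.
  by rewrite ffunE vu mulr0 mul0r.
have := h' phi psi; rewrite h !E; apply: mulfI.
by rewrite gt_eqF ?vweight_gt0.
Qed.

Lemma delta0E (psi : C1) (u : vertex) :
  delta0 psi u = \sum_(e : edge | tgt e == u)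
      eweight (src e) (tgt e) / vweight u * (val psi) e.
Proof.
by rewrite (adjoint_unique delta0_adjoint codiff0_adjoint) lfunE ffunE.
Qed.

Lemma sum_edges (u : vertex) (F : vertex -> R) :
  \sum_(e : edge | tgt e == u) F (src e) =
  \sum_(v : vertex | adjacent X (val u) (val v)) F v.
Proof.
rewrite [RHS](reindex_omap src (fun v => insub (v, u) : option edge)) /=.
  apply: eq_bigl => e; apply/idP/andP => [/eqP <-|[_ /eqP]].
    split; first by rewrite adjacentC (valP e).
    suff <- : val e = (src e, tgt e) by rewrite valK.
    by rewrite /src /tgt -surjective_pairing.
  by case: insubP => // e' _ e'E [ee']; rewrite -ee' /tgt e'E.
move=> v uv; have vu : adjacent X (val (v, u).1) (val (v, u).2).
  by rewrite adjacentC.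
by rewrite insubT.
Qed.

Lemma laplacian_sum (phi : C0) (u : vertex) :
  laplacian phi u =
  \sum_(v : vertex | adjacent X (val u) (val v))
     eweight u v / vweight u * (phi u - phi v).
Proof.
rewrite -(sum_edges u (fun v => eweight u v / vweight u * (phi u - phi v))).
rewrite comp_lfunE delta0E; apply: eq_bigr => e /eqP <-.
by rewrite d0E eweightC.
Qed.

Lemma eweight_sum (u : vertex) : (0 < n)%N ->
  \sum_(v : vertex | adjacent X (val u) (val v)) eweight u v = vweight u.
Proof.
move=> n0; have uX : [set val u] \in faces X by have := valP u; rewrite inE.
rewrite /vweight -(weight_balanced uX) ?cards1 //.
rewrite [RHS](reindex_omap (fun v : vertex => [set val u; val v])
  (fun s => [pick v : vertex | adjacent X (val u) (val v)
                               && (s == [set val u; val v])])) /=.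
  apply: eq_bigl => v; apply/idP/idP.
    move=> uv; have /andP[uNv uvX] := uv.
    rewrite uvX cards2 uNv sub1set set21 /=.
    case: pickP => [w /andP[/andP[uNw _] /eqP/setP/(_ (val w))]|/(_ v)].
      rewrite !inE eqxx orbT eq_sym (negPf uNw) /= => /eqP/val_inj ->.
      exact: eqxx.
    by rewrite uv eqxx.
  move=> /andP[/andP[sX /andP[+ _]] _].
  by rewrite cards2 /adjacent sX andbT; case: (_ != _).
move=> s /andP[sX /andP[/cards2P[a [b [ab sE]]] us]].
have [v vX vE] : exists2 v, v \in vertices X & s = [set val u; v] /\ val u != v.
  have sub1 w : w \in s -> w \in vertices X.
    move=> ws; rewrite inE; have [_ h] := complex_faces X.
    by apply: h sX; rewrite sub1set.
  move: us; rewrite sub1set sE !inE => /orP[] /eqP uE'.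
    have uE : val u = a := uE'.
    by exists b; [apply: sub1; rewrite sE set22|rewrite uE].
  have uE : val u = b := uE'.
  exists a; first by apply: sub1; rewrite sE set21.
  by rewrite uE setUC eq_sym.
case: pickP => [w /andP[_ /eqP ->] //|/(_ (exist _ v vX))] /=.
have [sE' uv] := vE; by rewrite /adjacent /= uv -sE' sX eqxx.
Qed.

Lemma laplacianE (phi : C0) (u : vertex) : (0 < n)%N ->
  laplacian phi u =
  phi u - \sum_(v : vertex | adjacent X (val u) (val v))
            eweight u v / vweight u * phi v.
Proof.
move=> n0; rewrite laplacian_sum.
under eq_bigr do rewrite mulrBr.
rewrite sumrB -!mulr_suml eweight_sum // mulfV ?mul1r //.
by rewrite gt_eqF ?vweight_gt0.
Qed.

Definition side_fun (S : {set V}) : C0 :=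
  [ffun u => if val u \in S then n%:R else - 1].

End Laplacian.

(* Main.v *)
Require Import Defs.
From HB Require Import structures.
From mathcomp Require Import all_boot all_order all_algebra.
From mathcomp Require Import boolp reals ring.

(** Call the n-simplices chambers, and write T phi s for the sum of phi over
the vertices of the chamber s.

Balancedness, iterated, expresses the weight of a face t as (n + 1 - #|t|)!
times the total weight of the chambers containing t ([weight_chambers]).
Substituting this in the formula for the Laplacian gives
[Delta = (n + 1) / n - A], where A phi u is (n - 1)! / m(u) times the sum of
m(s) T phi s over the chambers s containing u ([laplacian_chambers]).  The
operator A is positive semidefinite, since [<A phi, phi>] is (n - 1)! times
the sum of m(s) (T phi s)^2 over all chambers s.  Hence phi is in the
eigenspace of [(n + 1) / n] exactly when T phi vanishes on every chamber
([leigenspace_chambers]).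

A chamber has n + 1 pairwise adjacent vertices, hence exactly one in each of
the n + 1 sides ([card_chamber_side]).  So T vanishes on the functions phi_i,
which are therefore eigenfunctions.  Conversely let T phi vanish on every
chamber.  If two chambers share n vertices, their remaining vertices lie in
the same side, and phi agrees on them because both total sums are 0.  Thus
the value of phi at the vertex of a chamber in the side S_i is the same for
two such neighbouring chambers ([side_sum_adjacent]), and connectedness of
the links propagates this to all chambers ([chambers_invariant]).  So phi is
constant, say c_i, on each side S_i, the c_i have sum 0, and phi is the sum
of the functions [c_i / (n + 1)] phi_i. *)

Set Implicit Arguments.
Unset Strict Implicit.
Unset Printing Implicit Defensive.

Import Order.TTheory GRing.Theory Num.Theory.
Local Open Scope ring_scope.

(** * Chambers and galleries of a pure complex *)

Section Chambers.
Context (V : finType) (n : nat).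
Implicit Types (X : {set {set V}}) (s t : {set V}).

Definition chambers X : {set {set V}} := [set s in X | #|s| == n.+1].

Lemma chambers_face X s : s \in chambers X -> s \in X.
Proof. by rewrite inE => /andP[]. Qed.

Lemma card_chamber X s : s \in chambers X -> #|s| = n.+1.
Proof. by rewrite inE => /andP[_ /eqP]. Qed.

Lemma face_sub_chamber X t :
  pure n X -> t \in X -> exists2 s, s \in chambers X & t \subset s.
Proof.
by move=> Xp /Xp[s [sX /eqP sn ts]]; exists s; rewrite // inE sX.
Qed.

Lemma exists_chamber X : is_complex X -> pure n X -> exists s, s \in chambers X.
Proof.
by move=> [X0 _] Xp; have [s sX _] := face_sub_chamber Xp X0; exists s.
Qed.

Lemma dim_link_gt0 X t s : is_complex X -> s \in chambers X -> t \subset s ->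
  (#|t| < n)%N -> 0 < complex_dim (link X t).
Proof.
move=> [_ Xdown] sX ts tn; have sF := chambers_face sX.
have lX : s :\: t \in link X t.
  rewrite inE disjoints_subset subsetDr /=.
  have down (r : {set V}) : r \subset s -> r \in X by move/Xdown; apply.
  by rewrite !down ?subUset ?ts ?subsetDl.
rewrite /complex_dim subr_gt0 ltz_nat.
apply: leq_trans (leq_bigmax_cond (F := fun s : {set V} => #|s|) _ lX).
by rewrite cardsD (setIidPr ts) (card_chamber sX) ltn_subRL addn1 ltnS.
Qed.

Lemma chamber_vertex_link X t s v : is_complex X -> s \in X -> t \subset s ->
  v \in s -> v \notin t -> v \in vertices (link X t).
Proof.
move=> [_ Xdown] sX ts vs vt; rewrite !inE disjoints1 vt /=.
have down (r : {set V}) : r \subset s -> r \in X by move/Xdown; apply.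
by rewrite !down ?subUset ?ts ?sub1set.
Qed.

(** Two chambers need not share n vertices, but the connected links join them
by a chain of chambers in which consecutive ones do.  The chain is not built:
the invariance is proved for the chambers containing a given face t, by
descending induction on #|t|.  If #|t| = n this is the hypothesis on f.
Otherwise the link of t is connected; along an edge uw of that link, a chamber
containing t, u and w serves as an intermediate step between a chamber
containing t and u and one containing t and w. *)
Lemma chambers_invariant X (T : Type) (f : {set V} -> T) :
  is_complex X -> pure n X ->
  (forall t, t \in X -> 0 < complex_dim (link X t) ->
     complex_connected (link X t)) ->
  (forall t s s', s \in chambers X -> s' \in chambers X ->
     #|t| = n -> t \subset s -> t \subset s' -> f s = f s') ->
  forall s s', s \in chambers X -> s' \in chambers X -> f s = f s'.
Proof.
move=> Xc Xp Xconn fadj.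
suff key k t : (#|t| + k)%N = n -> forall s s', s \in chambers X ->
    s' \in chambers X -> t \subset s -> t \subset s' -> f s = f s'.
  by move=> s s' sX s'X; apply: (key n set0); rewrite ?cards0 ?sub0set.
elim: k t => [|k IHk] t tk s s' sX s'X ts ts'.
  by apply: (fadj t) => //; rewrite -tk addn0.
have tn : (#|t| < n)%N by rewrite -tk addnS ltnS leq_addr.
have tX : t \in X by case: Xc => _ /(_ s t ts); apply; apply: chambers_face sX.
have IHv v r r' : v \notin t -> r \in chambers X -> r' \in chambers X ->
    v |: t \subset r -> v |: t \subset r' -> f r = f r'.
  by move=> vt; apply: IHk; rewrite cardsU1 vt -tk addnS.
have out r : r \in chambers X -> exists2 v, v \in r & v \notin t.
  move=> rX; apply/subsetPn/negP => /subset_leq_card.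
  by rewrite (card_chamber rX) leqNgt ltnS ltnW.
have [u us ut] := out s sX; have [v vs' vt] := out s' s'X.
have uL : u \in vertices (link X t).
  by apply: (chamber_vertex_link Xc _ ts) => //; apply: chambers_face.
have vL : v \in vertices (link X t).
  by apply: (chamber_vertex_link Xc _ ts') => //; apply: chambers_face.
have /connectP[p] := Xconn t tX (dim_link_gt0 Xc sX ts tn) u v uL vL.
have subU1 w (r : {set V}) : w \in r -> t \subset r -> w |: t \subset r.
  by move=> wr tr; rewrite subUset sub1set wr.
elim: p u s sX ts us ut {uL} => [|w p IHp] u s sX ts us ut /=.
  by move=> _ uv; apply: (IHv u); rewrite ?subU1 // -uv.
case/andP=> /andP[_ uwL] pw vE.
have := uwL; rewrite !inE => /and3P[_ /pred0P dis uwtX].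
have [r rX uwtr] := face_sub_chamber Xp uwtX.
move: uwtr; rewrite subUset subUset !sub1set => /and3P[tr ur wr].
have wt : w \notin t by apply/negP => wt; have /= := dis w; rewrite set22 wt.
rewrite (IHv u s r) ?subU1 //; exact: (IHp w).
Qed.

(** Two vertices of a chamber are adjacent, so a side contains at most one of
them; and n + 1 numbers that are at most 1 and have sum n + 1 are all 1. *)
Lemma card_chamber_side X (S : 'I_n.+1 -> {set V}) s i :
  is_complex X -> partite X S -> s \in chambers X -> #|s :&: S i| = 1%N.
Proof.
move=> [_ Xdown] [SV Sd Se] sX; have sF := chambers_face sX.
have le1 j : (#|s :&: S j| <= 1)%N.
  rewrite leqNgt; apply/negP => /card_gt1P[u [v [+ + uv]]].
  rewrite !inE => /andP[us uj] /andP[vs vj].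
  have /Se/(_ uj vj) : adjacent X u v.
    by rewrite /adjacent uv (Xdown s) // subUset !sub1set us.
  by rewrite eqxx.
have sE : s = \bigcup_j (s :&: S j).
  rewrite -big_distrr /= -SV; apply/esym/setIidPl/subsetP => v vs.
  by rewrite inE (Xdown s) // sub1set.
have tot : (\sum_j #|s :&: S j| = \sum_(j < n.+1) 1)%N.
  rewrite sum1_card card_ord; apply: etrans (card_chamber sX).
  rewrite [in RHS]sE -[RHS]sum1_card.
  rewrite partition_disjoint_bigcup /=.
    by apply: eq_bigr => j; rewrite sum1_card.
  move=> j k /Sd jk; apply: disjointWl (subsetIr _ _) _.
  by apply: disjointWr (subsetIr _ _) _.
have := leqif_sum (fun j (_ : true) => leqif_eq (le1 j)).
by rewrite tot => -[_ /esym]; rewrite eqxx => /forallP/(_ i)/eqP.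
Qed.

End Chambers.

(** * The Laplacian in terms of chambers *)

Section Weights.
Context (R : realType) (n : nat) (V : finType) (X : weighted_complex R n V).

(** Balancedness spreads the weight of t over the faces with one more vertex;
after k steps a chamber s has been reached once for each of the k! orders in
which the vertices of s outside t can be added. *)
Lemma weight_chambers k (t : {set V}) : t \in faces X -> (#|t| + k)%N = n.+1 ->
  weight X t = k`!%:R * \sum_(s in chambers n X | t \subset s) weight X s.
Proof.
elim: k t => [|k IHk] t tX tk.
  rewrite mul1r (big_pred1 t) // => s /=; rewrite inE -tk addn0.
  apply/andP/eqP => [[/andP[_ /eqP st] ts]|->]; last by rewrite tX eqxx.
  by apply/eqP; rewrite eq_sym eqEcard ts st leqnn.
have tn : (#|t| <= n)%N by rewrite -ltnS -tk addnS ltnS leq_addr.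
rewrite -(weight_balanced tX tn).
rewrite (eq_bigr (fun s : {set V} => k`!%:R *
    \sum_(r in chambers n X | s \subset r) weight X r)); last first.
  by move=> s /and3P[sX /eqP st _]; apply: IHk => //; rewrite st addSnnS.
rewrite -mulr_sumr (exchange_big_dep (fun r : {set V} => (r \in chambers n X) &&
    (t \subset r))) /=; last first.
  by move=> s r /and3P[_ _ ts] /andP[-> /(subset_trans ts) ->].
(* A chamber containing t contains k + 1 faces that add one vertex to t. *)
rewrite factS mulnC natrM -mulrA; congr (_ * _).
rewrite mulr_sumr; apply: eq_bigr => r /andP[rX tr].
rewrite sumr_const mulr_natl; congr (_ *+ _).
transitivity #|[set x |: t | x in r :\: t]|.
  apply: eq_card => s; rewrite unfold_in rX /=; apply/idP/imsetP.
    move=> /andP[/and3P[sX /eqP st ts] sr].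
    have /cards1P[x xE] : #|s :\: t| == 1%N.
      by rewrite cardsD (setIidPr ts) st subSnn.
    exists x; first by rewrite (subsetP (setSD _ sr)) // xE set11.
    by rewrite -xE setUC setDE setUIr setUCr setIT (setUidPr ts).
  move=> [x /setDP[xr xt] ->]; rewrite cardsU1 xt subsetUr eqxx !andbT /=.
  have xtr : x |: t \subset r by rewrite subUset sub1set xr.
  have [_ Xdown] := complex_faces X.
  by rewrite xtr andbT; apply: Xdown (chambers_face rX).
rewrite card_in_imset => [|x y /setDP[_ xt] /setDP[_ yt] /setP/(_ x)].
  by rewrite cardsD (setIidPr tr) (card_chamber rX) -tk addKn.
by rewrite !inE eqxx (negPf xt) !orbF => /esym/eqP.
Qed.

Definition chamber_sum (phi : C0 X) (s : {set V}) : R :=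
  \sum_(v : vertex X | val v \in s) phi v.

(** Both m(u) and m(uv) are factorials times sums over chambers.  In the
average of phi over the neighbours of u, each chamber s through u contributes
T phi s - phi u, and the terms in phi u add up to - phi u / n. *)
Lemma laplacian_chambers (phi : C0 X) (u : vertex X) : (0 < n)%N ->
  laplacian X phi u = n.+1%:R / n%:R * phi u - n.-1`!%:R / vweight u *
    \sum_(s in chambers n X | val u \in s) weight X s * chamber_sum phi s.
Proof.
move=> n0; have [_ Xdown] := complex_faces X.
have uX : [set val u] \in faces X by have := valP u; rewrite inE.
have n0R : n%:R != 0 :> R by rewrite pnatr_eq0 -lt0n.
have w0 : vweight u != 0 by rewrite gt_eqF ?vweight_gt0.
have fE : (n`! = n * n.-1`!)%N by rewrite -[in LHS](prednK n0) factS prednK.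
have wE : vweight u =
    n%:R * n.-1`!%:R * \sum_(s in chambers n X | val u \in s) weight X s.
  rewrite /vweight (weight_chambers (k := n)) ?cards1 // -natrM -fE.
  by congr (_ * _); apply: eq_bigl => s; rewrite sub1set.
have E : \sum_(v : vertex X | adjacent X (val u) (val v)) eweight u v * phi v =
    n.-1`!%:R * \sum_(s in chambers n X | val u \in s)
       weight X s * (chamber_sum phi s - phi u).
  rewrite (eq_bigr (fun v => n.-1`!%:R * \sum_(s in chambers n X |
      [set val u; val v] \subset s) weight X s * phi v)); last first.
    move=> v /andP[uv uvX]; rewrite -mulr_suml mulrA.
    rewrite /eweight (weight_chambers (k := n.-1)) //.
    by rewrite cards2 uv addSnnS prednK.
  rewrite -mulr_sumr; congr (_ * _).
  rewrite (exchange_big_dep (fun s : {set V} =>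
      (s \in chambers n X) && (val u \in s))) /=.
    apply: eq_bigr => s /andP[sX us]; rewrite -mulr_sumr; congr (_ * _).
    rewrite /chamber_sum [in RHS](bigD1 u) //= [RHS]addrAC subrr add0r.
    apply: eq_bigl => v.
    rewrite sX subUset !sub1set us /= /adjacent andbC eq_sym.
    have [vs /=|//] := boolP (val v \in s).
    by rewrite (Xdown s) ?(chambers_face sX) ?andbT // subUset !sub1set us.
  by move=> v s _ /andP[->]; rewrite subUset !sub1set => /andP[->].
rewrite laplacianE //.
(* Collecting the weights of the chambers through u gives back m(u) / n. *)
under eq_bigr do rewrite mulrAC.
rewrite -mulr_suml E.
under eq_bigr do rewrite mulrBr.
rewrite sumrB -mulr_suml.
set A := \sum_(s in _ | _) _; set W := \sum_(s in _ | _) _ in wE *.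
have {}wE : n.-1`!%:R * W = vweight u / n%:R by rewrite wE; field.
rewrite mulrBr mulrA wE -natr1; field.
by rewrite n0R w0.
Qed.

(** By [laplacian_chambers] the eigenvalue equation at u says that the sum of
m(s) T phi s over the chambers s through u is 0.  Multiplying by phi u and
summing over u turns this into the vanishing of a sum of squares. *)
Lemma leigenspace_chambers (phi : C0 X) : (0 < n)%N ->
  (phi \in passmx.leigenspace (laplacian X) (n.+1%:R / n%:R)) <->
  (forall s, s \in chambers n X -> chamber_sum phi s = 0).
Proof.
move=> n0; rewrite memv_ker add_lfunE opp_lfunE scale_lfunE id_lfunE subr_eq0.
split=> [/eqP/ffunP phiE|phi0]; last first.
  apply/eqP/ffunP => u; rewrite laplacian_chambers // ffunE.
  rewrite [X in _ - _ * X]big1 ?mulr0 ?subr0 //.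
  by move=> s /andP[/phi0 -> _]; rewrite mulr0.
have A0 (u : vertex X) : \sum_(s in chambers n X | val u \in s)
    weight X s * chamber_sum phi s = 0.
  have /eqP := phiE u; rewrite laplacian_chambers // ffunE.
  rewrite subr_eq addrC -subr_eq subrr eq_sym mulf_eq0 => /orP[|/eqP //].
  rewrite mulf_eq0 invr_eq0 pnatr_eq0 -[_ == 0%N]negbK -lt0n fact_gt0 /=.
  by rewrite gt_eqF ?vweight_gt0.
have wpos s : s \in chambers n X -> 0 < weight X s.
  by move=> /chambers_face/weight_gt0.
have : \sum_(s in chambers n X) weight X s * chamber_sum phi s ^+ 2 = 0.
  transitivity (\sum_(u : vertex X) phi u *
      \sum_(s in chambers n X | val u \in s) weight X s * chamber_sum phi s).
    2: by apply: big1 => u _; rewrite A0 mulr0.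
  under [RHS]eq_bigr do rewrite mulr_sumr.
  rewrite (exchange_big_dep (mem (chambers n X))) /=; last first.
    by move=> u s _ /andP[].
  apply: eq_bigr => s sX; rewrite -mulr_suml [RHS]mulrCA; congr (_ * _).
  by rewrite expr2; congr (_ * _); apply: eq_bigl => u; rewrite sX.
move=> /psumr_eq0P sq0 s sX; apply/eqP; rewrite -sqrf_eq0.
have /eqP : weight X s * chamber_sum phi s ^+ 2 = 0.
  by apply: sq0 => // r /wpos w; rewrite mulr_ge0 ?sqr_ge0 ?ltW.
by rewrite mulf_eq0 gt_eqF ?wpos.
Qed.

Lemma sum_vertices_in (s : {set V}) (F : V -> R) : s \in faces X ->
  \sum_(v : vertex X | val v \in s) F (val v) = \sum_(v in s) F v.
Proof.
move=> sX; have [_ Xdown] := complex_faces X.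
rewrite [RHS](reindex_omap (val : vertex X -> V) insub) /=.
  by apply: eq_bigl => v; rewrite valK eqxx andbT.
move=> v vs; have vX : v \in vertices X by rewrite inE (Xdown s) // sub1set.
by rewrite insubT.
Qed.

(** When A is a side and s a chamber, this is the value of phi at the vertex of
s in A; a sum is total in s, so no vertex has to be chosen. *)
Definition side_sum (phi : C0 X) (A s : {set V}) : R :=
  chamber_sum phi (s :&: A).

End Weights.

(** * Functions on a partite complex *)

Section Partite.
Context (R : realType) (n : nat) (V : finType) (X : weighted_complex R n V).
Context (S : 'I_n.+1 -> {set V}) (Sp : partite X S).

Lemma chamber_sum_side_fun (s : {set V}) i :
  s \in chambers n X -> chamber_sum (side_fun X (S i)) s = 0.
Proof.
move=> sX; have sF := chambers_face sX.
pose F v : R := (if v \in S i then n.+1%:R else 0) - 1.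
rewrite /chamber_sum (eq_bigr (fun v => F (val v))) => [|v _]; last first.
  rewrite ffunE /F; case: ifP => _; last by rewrite sub0r.
  by rewrite -natr1 addrK.
rewrite sum_vertices_in // sumrB -big_mkcondr /=.
under eq_bigl do rewrite -in_setI.
rewrite !sumr_const (card_chamber_side i (complex_faces X) Sp sX).
by rewrite (card_chamber sX) subrr.
Qed.

Lemma side_of_vertex (v : vertex X) : exists i, val v \in S i.
Proof.
case: Sp => SV _ _; have /bigcupP[i _ vi] : val v \in \bigcup_i S i.
  by rewrite -SV; apply: valP.
by exists i.
Qed.

Lemma side_inj (v : V) i j : v \in S i -> v \in S j -> i = j.
Proof.
case: Sp => _ Sd _ vi vj; apply/eqP/negPn/negP => /Sd/pred0P/(_ v)/=.
by rewrite vi vj.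
Qed.

Lemma side_sum_chamber (phi : C0 X) (s : {set V}) i (v : vertex X) :
  s \in chambers n X -> val v \in s -> val v \in S i ->
  side_sum phi (S i) s = phi v.
Proof.
move=> sX vs vi.
have /eqP/cards1P[x xE] := card_chamber_side i (complex_faces X) Sp sX.
have vx : val v = x by apply/set1P; rewrite -xE inE vs.
rewrite /side_sum /chamber_sum (big_pred1 v) // => w /=.
by rewrite xE in_set1 -vx.
Qed.

Lemma chamber_sum_sides (phi : C0 X) (s : {set V}) : s \in faces X ->
  chamber_sum phi s = \sum_i side_sum phi (S i) s.
Proof.
move=> sX; rewrite /side_sum /chamber_sum.
rewrite (exchange_big_dep (fun v : vertex X => val v \in s)) /=; last first.
  by move=> i v _ /setIP[].
apply: eq_bigr => v vs; have [i vi] := side_of_vertex v.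
rewrite (big_pred1 i) // => j /=; rewrite inE vs /=.
by apply/idP/eqP => [/side_inj/(_ vi)|->].
Qed.

(** The common face t misses only one side.  On the sides that t meets, both
chambers have the same vertex; the value on the missed side is then determined
by the total sum, which is 0 for both chambers. *)
Lemma side_sum_adjacent (phi : C0 X) (s s' t : {set V}) i :
  (forall s, s \in chambers n X -> chamber_sum phi s = 0) ->
  s \in chambers n X -> s' \in chambers n X ->
  #|t| = n -> t \subset s -> t \subset s' ->
  side_sum phi (S i) s = side_sum phi (S i) s'.
Proof.
move=> phi0 sX s'X tn ts ts'.
have [_ Xdown] := complex_faces X.
have sideV r j : r \in chambers n X ->
    exists v : vertex X, val v \in r /\ val v \in S j.
  move=> rX; have /card_gt0P[x /setIP[xr xj]] : (0 < #|r :&: S j|)%N.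
    by rewrite (card_chamber_side j (complex_faces X) Sp rX).
  have xX : x \in vertices X.
    by rewrite inE (Xdown r) ?(chambers_face rX) // sub1set.
  by exists (exist _ x xX).
have meet j (v : vertex X) : val v \in t -> val v \in S j ->
    side_sum phi (S j) s = side_sum phi (S j) s'.
  move=> vt vj.
  by rewrite !(@side_sum_chamber _ _ j v) // (subsetP ts, subsetP ts').
have [v [vs vi]] := sideV s i sX.
have [vt|vt] := boolP (val v \in t); first exact: (meet i v).
(* The only vertex of s outside t is v, so t meets all the other sides. *)
have others j : j != i -> side_sum phi (S j) s = side_sum phi (S j) s'.
  move=> ji; have [w [ws wj]] := sideV s j sX.
  have [wt|wt] := boolP (val w \in t); first exact: (meet j w).
  have /cards1P[x xE] : #|s :\: t| == 1%N.
    by rewrite cardsD (setIidPr ts) (card_chamber sX) tn subSnn.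
  have /set1P vx : val v \in [set x] by rewrite -xE inE vt.
  have /set1P wx : val w \in [set x] by rewrite -xE inE wt.
  by rewrite (side_inj wj (_ : _ \in S i)) ?eqxx // wx -vx in ji.
have := phi0 s' s'X; rewrite -(phi0 s sX).
rewrite !chamber_sum_sides ?(chambers_face sX) ?(chambers_face s'X) //.
rewrite (bigD1 i) // [RHS](bigD1 i) //= (eq_bigr _ others).
by move/addIr.
Qed.

End Partite.

Theorem proposition5p2 (R : realType) (n : nat) (V : finType)
    (X : weighted_complex R n V) (S : 'I_n.+1 -> {set V}) :
  (1 <= n)%N ->
  (forall t : {set V}, t \in faces X ->
     0 < complex_dim (link X t) -> complex_connected (link X t)) ->
  partite X S ->
  passmx.leigenvalue (laplacian X) (n.+1%:R / n%:R) /\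
  passmx.leigenspace (laplacian X) (n.+1%:R / n%:R) =
    <<[seq side_fun X (S i) | i : 'I_n.+1]>>%VS.
Proof.
move=> n0 Xconn Sp; have Xc := complex_faces X; have Xp := @pure_faces _ _ _ X.
have [s sX] := exists_chamber Xc Xp; have sF := chambers_face sX.
have side_in i :
    side_fun X (S i) \in passmx.leigenspace (laplacian X) (n.+1%:R / n%:R).
  by apply/leigenspace_chambers => // r; apply: chamber_sum_side_fun.
split.
  apply/negP => /eqP E0.
  have := side_in ord0; rewrite E0 memv0 => /eqP/ffunP f0.
  have /card_gt0P[v /setIP[vs v0]] : (0 < #|s :&: S ord0|)%N.
    by rewrite (card_chamber_side ord0 Xc Sp sX).
  have vX : v \in vertices X by case: Xc => _ h; rewrite inE (h s) // sub1set.
  have /eqP := f0 (exist _ v vX); rewrite !ffunE /= v0 pnatr_eq0.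
  by rewrite -[_ == _]negbK -lt0n n0.
apply/eqP; rewrite eqEsubv; apply/andP; split; last first.
  by apply/span_subvP => _ /imageP[i _ ->].
apply/subvP => phi /(leigenspace_chambers _ n0) phi0.
pose c i := side_sum phi (S i) s.
have c0 : \sum_i c i = 0 by rewrite -(chamber_sum_sides Sp) // phi0.
have phiE v i : val v \in S i -> phi v = c i.
  move=> vi; have vX : [set val v] \in faces X by have := valP v; rewrite inE.
  have [r rX] := face_sub_chamber Xp vX; rewrite sub1set => vr.
  rewrite -(side_sum_chamber Sp phi rX vr vi).
  apply: (chambers_invariant (f := side_sum phi (S i)) Xc Xp Xconn) => //.
  by move=> t a b aX bX tn ta tb; apply: (side_sum_adjacent Sp i _ _ _ tn).
(* The constant terms -1 of the functions cancel because the c i sum to 0. *)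
have -> : phi = \sum_i (c i / n.+1%:R) *: side_fun X (S i).
  apply/ffunP => v; have [i vi] := side_of_vertex Sp v.
  rewrite (phiE v i vi) sum_ffunE.
  have E j : ((c j / n.+1%:R) *: side_fun X (S j)) v =
      (if j == i then c j else 0) - c j / n.+1%:R.
    rewrite !ffunE; have [->|ji] := eqVneq j i.
      rewrite vi /GRing.scale /=; field.
      by rewrite nat1r pnatr_eq0.
    case: ifP => [/(side_inj Sp)/(_ vi) ij|_]; first by rewrite ij eqxx in ji.
    by rewrite /GRing.scale /= mulrN1 sub0r.
  under eq_bigr do rewrite E.
  by rewrite sumrB -mulr_suml c0 mul0r subr0 -big_mkcond big_pred1_eq.
apply: memv_suml => i _; apply: memvZ; apply: memv_span.
by apply/imageP; exists i.
Qed.
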